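(* Let $A,B\in\mathbb{Z}$ with $A\equiv B\equiv 1\pmod 4$, and let $\mathcal{F}_{3,A,B}(x)=x^{8}+Ax^{6}+Bx^{4}+Ax^{2}+1$. Then $\mathcal{F}_{3,A,B}(x)$ is reducible over $\mathbb{Q}$ if and only if there exist $s,t\in\mathbb{Z}$ such that \[A=4t-4s^2-4s+1\quad\text{and}\quad B\in\{4t^2+4t-8s^2-8s+1,\ 4t^2+4t+8s^2+8s+5\}.\] *)

(* Defs.v *)
From mathcomp Require Import all_boot all_order all_algebra.

Set Implicit Arguments.
Unset Strict Implicit.
Unset Printing Implicit Defensive.

Import GRing.Theory.
Local Open Scope ring_scope.

Definition F3 (A B : int) : {poly rat} :=
  'X^8 + A%:~R *: 'X^6 + B%:~R *: 'X^4 + A%:~R *: 'X^2 + 1.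

(* For a zero or constant p this also holds; it is the usual notion on
   polynomials of positive degree, such as [F3 A B]. *)
Definition reducible (p : {poly rat}) : Prop := ~ irreducible_poly p.

(* Main.v *)
(** Modulo 2 the polynomial [F3 A B] is the square of the fifth cyclotomic
    polynomial, which is irreducible over F_2.  By Gauss's lemma a proper
    factorization of [F3 A B] is therefore, up to sign, a product of two monic
    quartics with integer coefficients, all odd.  Since the coefficients of
    x^7, x and x^5 vanish, the factors are
    x^4 + a x^3 + b x^2 + c x + e and x^4 - a x^3 + b x^2 - c x + e with e = 1
    or e = -1.  Comparing the coefficients of x^6 and x^2, e = -1 gives
    4 b = a^2 - c^2, impossible because 8 divides the right-hand side and b is
    odd, while e = 1 gives c = a or c = -a: these are the two families, with
    a = 2 s + 1 and b = 2 t + 1. *)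
Require Import Defs.
From mathcomp Require Import all_boot all_order all_algebra.
From mathcomp Require Import zify ring.
From Stdlib Require Import Classical.

Set Implicit Arguments.
Unset Strict Implicit.
Unset Printing Implicit Defensive.

Import GRing.Theory.
Local Open Scope ring_scope.

(** Reduction modulo 2, with [bool] under [addb] and [andb] playing the field F_2. *)
Definition oddz (x : int) : bool := odd `|x|%N.

Lemma oddzM : {morph oddz : x y / x * y >-> x && y}.
Proof. by move=> x y; rewrite /oddz abszM oddM. Qed.

Lemma oddzD : {morph oddz : x y / x + y >-> x (+) y}.
Proof. move=> x y; rewrite /oddz; lia. Qed.

Lemma oddzN (x : int) : oddz (- x) = oddz x.
Proof. by rewrite /oddz abszN. Qed.

Lemma oddz_mod4 (x : int) : (x = 1 %[mod 4])%Z -> oddz x.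
Proof. rewrite /oddz; lia. Qed.

Lemma oddzE (x : int) : oddz x -> exists y, x = 2 * y + 1.
Proof. by rewrite /oddz => ox; exists (x %/ 2)%Z; lia. Qed.

Fixpoint bitseqs n : seq bitseq :=
  if n is m.+1 then
    [seq false :: s | s <- bitseqs m] ++ [seq true :: s | s <- bitseqs m]
  else [:: [::]].

Lemma mem_bitseqs (s : bitseq) : s \in bitseqs (size s).
Proof.
elim: s => [|b s IHs] //=; rewrite mem_cat.
by case: b; rewrite (map_f _ IHs) ?orbT.
Qed.

(** Bit lists, lowest degree first, stand for polynomials over F_2; this is the coefficient of x^k
    in a product, in a form that [vm_compute] can evaluate. *)
Definition conv2 (s t : bitseq) (k : nat) : bool :=
  foldr addb false
    [seq nth false s j && nth false t (k - j)%N | j <- iota 0 k.+1].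

(* [~~ odd k] is the k-th coefficient of the square of the fifth cyclotomic
   polynomial modulo 2; the finitely many candidate factors are enumerated. *)
Lemma Phi5_sqr_factor (s t : bitseq) :
    (1 < size s <= 5)%N -> (size s + size t = 10)%N ->
    (forall k, (k <= 8)%N -> conv2 s t k = ~~ odd k) ->
  s = nseq 5 true.
Proof.
move=> s15 st10 stE.
have /allP/(_ (size s)) : all (fun d => all (fun s => all (fun t =>
    all (fun k => conv2 s t k == ~~ odd k) (iota 0 9) ==> (s == nseq 5 true))
    (bitseqs (10 - d))) (bitseqs d)) (iota 2 4) by vm_compute.
rewrite mem_iota => /(_ s15)/allP/(_ _ (mem_bitseqs s)).
rewrite -st10 addKn => /allP/(_ _ (mem_bitseqs t))/implyP H.
by apply/eqP/H/allP => k; rewrite mem_iota => k9; apply/eqP/stE.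
Qed.

Lemma oddz_coefM (p q : {poly int}) k :
  conv2 (map oddz p) (map oddz q) k = oddz (p * q)`_k.
Proof.
have nthE (r : {poly int}) i : nth false (map oddz r) i = oddz r`_i.
  case: (ltnP i (size r)) => ir; first by rewrite (nth_map 0).
  by rewrite !nth_default ?size_map.
rewrite coefM (big_morph oddz oddzD (erefl : oddz 0 = false)).
rewrite /conv2 foldrE big_map -(big_mkord xpredT
  (fun j => oddz (p`_j * q`_(k - j)))) /index_iota subn0.
by apply: eq_bigr => j _; rewrite oddzM !nthE.
Qed.

Lemma mulz_eq1 (x y : int) :
  x * y = 1 -> (x = 1 /\ y = 1) \/ (x = -1 /\ y = -1).
Proof.
move=> xy1; have /eqP := congr1 absz xy1.
rewrite abszM muln_eq1 => /andP[/eqP x1 _].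
have [Ex|Ex] : x = 1 \/ x = -1 by lia.
  by left; move: xy1; rewrite Ex mul1r.
by right; split=> //; move: xy1; rewrite Ex; lia.
Qed.

(** Linearizes the fact that odd squares are 1 modulo 8: (2 s + 1)^2 = 4 (s * s + s) + 1 = 8 v +
    1. *)
Lemma mulz_succ_even (s : int) : exists v, s * s + s = 2 * v.
Proof.
have [E|E] : s = 2 * (s %/ 2)%Z \/ s = 2 * (s %/ 2)%Z + 1 by lia.
  by exists ((s %/ 2)%Z * (s + 1)); rewrite {1 2}E; nia.
by exists (s * ((s %/ 2)%Z + 1)); nia.
Qed.

Lemma quartic_factors_Z (A B a b c e a' b' c' e' : int) :
    oddz a -> oddz b -> oddz c ->
    a + a' = 0 -> b + b' + a * a' = A -> c + c' + a * b' + a' * b = 0 ->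
    e + e' + a * c' + a' * c + b * b' = B ->
    b * e' + b' * e + c * c' = A -> c * e' + c' * e = 0 -> e * e' = 1 ->
  exists s t : int,
    A = 4 * t - 4 * s ^+ 2 - 4 * s + 1 /\
    (B = 4 * t ^+ 2 + 4 * t - 8 * s ^+ 2 - 8 * s + 1 \/
     B = 4 * t ^+ 2 + 4 * t + 8 * s ^+ 2 + 8 * s + 5).
Proof.
move=> /oddzE[s Ea] /oddzE[t Eb] /oddzE[u Ec] h7 h6 h5 h4 h2 h1 h0.
have ee := mulz_eq1 h0.
have Ea' : a' = - a by lia.
have Ec' : c' = - c by lia.
have Eb' : b' = b.
  (* This is the x^5 coefficient once a' = - a and c' = - c; the factor a = 2 s + 1 cannot
     vanish. *)
  have/eqP: a * (b' - b) = 0 by rewrite -h5 Ea' Ec'; ring.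
  by rewrite mulf_eq0 subr_eq0 => /orP[/eqP|/eqP //]; lia.
subst a' b' c'.
case: ee => [[? ?]|[? ?]]; subst e e'.
  have/eqP: (c - a) * (c + a) = 0.
    have -> : (c - a) * (c + a) = (b + b + a * - a) - (b * 1 + b * 1 + c * - c).
      by ring.
    by rewrite h6 h2 subrr.
  rewrite mulf_eq0 subr_eq0 addr_eq0 => /orP[] /eqP Eca; exists s, t; split.
  - rewrite -h6 Ea Eb; ring.
  - by left; rewrite -h4 Eca Ea Eb; ring.
  - rewrite -h6 Ea Eb; ring.
  - by right; rewrite -h4 Eca Ea Eb; ring.
exfalso.
have [v Ev] := mulz_succ_even s; have [w Ew] := mulz_succ_even u.
move: h2; rewrite -h6 Ea Eb Ec; lia.
Qed.

Definition F3Z (A B : int) : {poly int} :=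
  'X^8 + A *: 'X^6 + B *: 'X^4 + A *: 'X^2 + 1.

Lemma map_F3Z A B : map_poly intr (F3Z A B) = F3 A B.
Proof.
by rewrite /F3Z /F3 !rmorphD /= !map_polyZ !map_polyXn rmorph1.
Qed.

Lemma coef_F3Z A B k :
  (F3Z A B)`_k = nth 0 [:: 1; 0; A; 0; B; 0; A; 0; 1] k.
Proof.
rewrite /F3Z !coefE.
by do 9?[case: k => [|k] /=]; rewrite ?(mulr0, mulr1, addr0, add0r) // nth_nil.
Qed.

Lemma size_F3Z A B : size (F3Z A B) = 9%N.
Proof.
apply/eqP; rewrite eqn_leq; apply/andP; split.
  by apply/leq_sizeP => k k9; rewrite coef_F3Z nth_default.
by rewrite ltnNge; apply/negP => /leq_sizeP/(_ 8 isT); rewrite coef_F3Z.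
Qed.

Lemma F3Z_factor (A B : int) (p q : {poly int}) :
    oddz A -> oddz B -> F3Z A B = p * q -> (1 < size p <= 5)%N ->
  exists s t : int,
    A = 4 * t - 4 * s ^+ 2 - 4 * s + 1 /\
    (B = 4 * t ^+ 2 + 4 * t - 8 * s ^+ 2 - 8 * s + 1 \/
     B = 4 * t ^+ 2 + 4 * t + 8 * s ^+ 2 + 8 * s + 5).
Proof.
move=> oA oB Epq sp.
have F0 : p * q != 0 by rewrite -Epq -size_poly_gt0 size_F3Z.
have [p0 q0] : p != 0 /\ q != 0 by apply/andP; rewrite -negb_or -mulf_eq0.
have sz : (size p + size q = 10)%N.
  have := size_mul p0 q0; rewrite -Epq size_F3Z.
  by case: (size p + size q)%N => //= n <-.
have pE : map oddz p = nseq 5 true.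
  (* As A and B are odd, the coefficients 1, 0, A, 0, B, 0, A, 0, 1 reduce to the alternating
     pattern [~~ odd k]. *)
  apply: (@Phi5_sqr_factor _ (map oddz q)); rewrite ?size_map // => k k8.
  rewrite oddz_coefM -Epq coef_F3Z.
  by do 9?[case: k k8 => [|k] k8] => //=; rewrite ?oA ?oB.
have sp5 : size p = 5%N by have := congr1 size pE; rewrite size_map.
have sq5 : size q = 5%N by lia.
have op i : (i < 5)%N -> oddz p`_i.
  by move=> i5; rewrite -(nth_map 0 false) ?sp5 // pE nth_nseq i5.
have pi i : (4 < i)%N -> p`_i = 0 by move=> i5; rewrite nth_default ?sp5.
have qi i : (4 < i)%N -> q`_i = 0 by move=> i5; rewrite nth_default ?sq5.
have Fk k : (\sum_(0 <= j < k.+1) p`_j * q`_(k - j))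
    = nth 0 [:: 1; 0; A; 0; B; 0; A; 0; 1] k.
  by rewrite big_mkord -coefM -Epq coef_F3Z.
have := (Fk 0%N, Fk 1%N, Fk 2%N, Fk 4%N, Fk 5%N, Fk 6%N, Fk 7%N, Fk 8%N).
rewrite unlock /= !(subn0, subSS).
rewrite !(pi 5%N, pi 6%N, pi 7%N, pi 8%N, qi 5%N, qi 6%N, qi 7%N, qi 8%N) //.
rewrite !(mulr0, mul0r, addr0, add0r).
move: (op 3%N isT) (op 2%N isT) (op 1%N isT).
move: p`_0 p`_1 p`_2 p`_3 p`_4 q`_0 q`_1 q`_2 q`_3 q`_4.
move=> e c b a x e' c' b' a' y oa ob oc [[[[[[[h0 h1] h2] h4] h5] h6] h7] h8].
(* The leading coefficients [x] and [y] are both 1 or both -1; in the second case both factors are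
   negated. *)
have [[Ex Ey]|[Ex Ey]] := mulz_eq1 h8; rewrite Ex Ey in h4 h5 h6 h7.
  by apply: (@quartic_factors_Z _ _ a b c e a' b' c' e'); rewrite //; lia.
apply: (@quartic_factors_Z _ _ (- a) (- b) (- c) (- e)
          (- a') (- b') (- c') (- e'));
  by rewrite ?oddzN //; lia.
Qed.

(** Difference of squares: (x^4 + b x^2 + 1)^2 - (a x^3 + c x)^2 has x^6 coefficient 2 b - a^2 and
    x^2 coefficient 2 b - c^2, which agree because a^2 = c^2. *)
Lemma reducible_F3 (a b c : int) : c = a \/ c = - a ->
  reducible (F3 (2 * b - a ^+ 2) (b ^+ 2 + 2 - 2 * a * c)).
Proof.
move=> ca [_ irrF].
pose g (a c : int) : {poly int} := 'X^4 + a *: 'X^3 + b *: 'X^2 + c *: 'X + 1.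
have gE : F3Z (2 * b - a ^+ 2) (b ^+ 2 + 2 - 2 * a * c) = g a c * g (- a) (- c).
  by rewrite /F3Z /g -!mul_polyC; case: ca => ->; ring.
have sg : size (g a c) = 5%N.
  have gk k : (g a c)`_k = nth 0 [:: 1; c; b; a; 1] k.
    rewrite /g !coefE.
    by do 5?[case: k => [|k] /=];
      rewrite ?(mulr0, mulr1, addr0, add0r) // nth_nil.
  apply/eqP; rewrite eqn_leq; apply/andP; split.
    by apply/leq_sizeP => k k5; rewrite gk nth_default.
  by rewrite ltnNge; apply/negP => /leq_sizeP/(_ 4%N isT); rewrite gk.
have sz (f : {poly int}) : size (map_poly intr f : {poly rat}) = size f.
  by apply: size_map_inj_poly; first exact: intr_inj.
have := irrF (map_poly intr (g a c)); rewrite sz sg -map_F3Z gE rmorphM /=.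
by move=> /(_ isT (dvdp_mulr _ (dvdpp _)))/eqp_size;
  rewrite -rmorphM -gE !sz size_F3Z sg.
Qed.

Theorem theorem1p2 (A B : int)
    (hA : (A = 1 %[mod 4])%Z) (hB : (B = 1 %[mod 4])%Z) :
  reducible (F3 A B) <->
  exists s t : int,
    A = 4 * t - 4 * s ^+ 2 - 4 * s + 1 /\
    (B = 4 * t ^+ 2 + 4 * t - 8 * s ^+ 2 - 8 * s + 1 \/
     B = 4 * t ^+ 2 + 4 * t + 8 * s ^+ 2 + 8 * s + 5).
Proof.
have oA := oddz_mod4 hA; have oB := oddz_mod4 hB.
split=> [red|[s [t [-> EB]]]].
  apply: NNPP => nost; apply: red; split=> [|q sq1].
    by rewrite -map_F3Z size_map_inj_poly ?size_F3Z //; apply: intr_inj.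
  rewrite -map_F3Z => qF; rewrite -dvdp_size_eqp //.
  (* Gauss's lemma: the rational divisor is a nonzero multiple of an integer polynomial [p] with an
     integer cofactor [r]. *)
  case/dvdpP_rat_int: qF sq1 => [p [a a0 ->] [r Er]].
  rewrite size_scale // !size_map_inj_poly //; try exact: intr_inj.
  have F0 : p * r != 0 by rewrite -Er -size_poly_gt0 size_F3Z.
  have [p0 r0] : p != 0 /\ r != 0 by apply/andP; rewrite -negb_or -mulf_eq0.
  have sz : (size p + size r = 10)%N.
    have := size_mul p0 r0; rewrite -Er size_F3Z.
    by case: (size p + size r)%N => //= n <-.
  rewrite size_F3Z => sp1; apply/eqP; apply: NNPP => sp9; apply: nost.
  have [sp5|sp5] := leqP (size p) 5.
    apply: (F3Z_factor oA oB Er).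
    by rewrite sp5 andbT ltn_neqAle eq_sym sp1 size_poly_gt0.
  (* Now [p] has size at least 6 and the sizes add up to 10, so [r] has size at most 4; it is not
     constant because [p] does not have size 9. *)
  apply: (@F3Z_factor _ _ r p oA oB); first by rewrite mulrC.
  by move: r0 sz sp5 sp9; rewrite -size_poly_gt0;
    move: (size p) (size r); lia.
(* In these variables the two values of B correspond to c = a and c = - a in [reducible_F3]. *)
pose a := 2 * s + 1; pose b := 2 * t + 1.
have -> : 4 * t - 4 * s ^+ 2 - 4 * s + 1 = 2 * b - a ^+ 2.
  by rewrite /a /b; ring.
case: EB => ->.
  have -> : 4 * t ^+ 2 + 4 * t - 8 * s ^+ 2 - 8 * s + 1
      = b ^+ 2 + 2 - 2 * a * a by rewrite /a /b; ring.
  by apply: reducible_F3; left.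
have -> : 4 * t ^+ 2 + 4 * t + 8 * s ^+ 2 + 8 * s + 5
    = b ^+ 2 + 2 - 2 * a * - a by rewrite /a /b; ring.
by apply: reducible_F3; right.
Qed.
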